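(* Let $X$ be a hereditarily Lindelöf topological space with $X\notin M(X)$ (equivalently, $X$ does not have the Menger property), so that $\mathrm{add}(M(X))$ is defined. Then $$\mathrm{add}(M(X))\ \geq\ \mathrm{add}(M(\mathbb{N}^\omega))\ \geq\ \mathfrak g .$$
   Context: A topological space $X$ has the Menger property (is Menger) if for every sequence $(u_n)_{n\in\omega}$ of open covers of $X$ there is a sequence $(v_n)_{n\in\omega}$ such that each $v_n$ is a finite subfamily of $u_n$ and $\{\bigcup v_n:n\in\omega\}$ is a cover of $X$. For a topological space $X$, $M(X)$ denotes the collection of all subsets of $X$ that are contained in some subspace of $X$ having the Menger property; it is a $\sigma$-ideal (closed under taking subsets and countable unions). For a $\sigma$-ideal $\mathcal I$ of subsets of a set $X$ with $\bigcup\mathcal I=X$ and $X\notin\mathcal I$, $\mathrm{add}(\mathcal I)$ is the smallest cardinality of a subfamily $\mathcal J\subset\mathcal I$ with $\bigcup\mathcal J\notin\mathcal I$. $\mathbb{N}^\omega$ is the Baire space (countable power of the discrete space $\mathbb N$). The cardinal $\mathfrak g$: let $C$ be a countably infinite set and let $[C]^{\aleph_0}$ be the set of its infinite subsets. Write $A\subset^\ast B$ if $A\setminus B$ is finite. A family $\mathcal D\subset[C]^{\aleph_0}$ is open if $A\in\mathcal D$ whenever $A\in[C]^{\aleph_0}$ and $A\subset^\ast B$ for some $B\in\mathcal D$. An open family $\mathcal D$ is groupwise dense if for every infinite collection $\Pi$ of finite pairwise disjoint subsets of $C$ there is an infinite $\mathcal H\subset\Pi$ with $\bigcup\mathcal H\in\mathcal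 D$. Then $\mathfrak g$ is the smallest cardinality of a collection of groupwise dense families with empty intersection. *)

(* Defs.v *)
From mathcomp Require Import all_boot finmap all_classical topology.

Set Implicit Arguments.
Unset Strict Implicit.
Unset Printing Implicit Defensive.

Local Open Scope classical_set_scope.
Local Open Scope card_scope.

(* A cardinal number is represented by a set of that cardinality, and cardinals
   are compared with [#<=].  [least_card F] is a member of [F] of smallest
   cardinality; by [least_cardP] it exists as soon as [F] is nonempty. *)
Definition least_card {T : Type} (F : set (set T)) : set T :=
  xget set0 [set A | F A /\ forall B, F B -> A #<= B].

Lemma least_cardP (T : Type) (F : set (set T)) : F !=set0 ->
  F (least_card F) /\ forall B, F B -> least_card F #<= B.
Proof.
move=> [A0 FA0]; apply: (@xgetPex _ set0 [set A | F A /\ forall B, F B -> A #<= B]).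
have [A00|/set0P[a0 _]] := eqVneq A0 set0.
  by exists A0; split=> // B _; rewrite A00; exact: card_ge0.
pose P (S : set (set T -> T)) :=
  (forall f, S f -> forall A, F A -> A (f A)) /\
  (forall A, F A -> forall f g, S f -> S g -> f A = g A -> f = g).
have [S [[SF Sinj] Smax]] : exists S, P S /\ forall S', S `<` S' -> ~ P S'.
  apply: Zorn_bigcup => G GP Gtot; split.
    by move=> f [S GS Sf]; apply: (GP S GS).1.
  move=> A FA f g [S GS Sf] [S' GS' Sg].
  have [SS'|S'S] := Gtot _ _ GS GS'.
    by apply: (GP S' GS').2 => //; exact: SS'.
  by apply: (GP S GS).2 => //; exact: S'S.
have [A FA SA] : exists2 A, F A & A `<=` (fun f => f A) @` S.
  apply: contrapT => nA.
  have {nA} /choice[g gP] : forall A, exists a,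
      F A -> A a /\ forall f, S f -> f A <> a.
    move=> A; have [FA|nFA] := pselect (F A); last by exists a0.
    apply: contrapT => na; case: nA; exists A => // a Aa.
    apply: contrapT => nSa; apply: na; exists a => _; split=> // f Sf fa.
    by apply: nSa; exists f.
  have nSg : ~ S g by move=> Sg; exact: ((gP A0 FA0).2 g Sg).
  apply: (Smax (S `|` [set g])).
    split; first by move=> f Sf; left.
    by move/(_ g (or_intror erefl)).
  split; first by move=> f [Sf|->] A FA; [exact: (SF f Sf A FA)|exact: (gP A FA).1].
  move=> A FA f h [Sf|->] [Sh|->] //; first exact: Sinj.
    by move=> /((gP A FA).2 f Sf).
  by move=> /esym/((gP A FA).2 h Sh).
exists A; split=> // B FB.
apply: (card_le_trans (subset_card_le SA)).
apply: (card_le_trans (card_image_le _ _)).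
have /card_eqPle[_ SB] : (fun f => f B) @` S #= S.
  by apply: inj_card_eq => f g /set_mem Sf /set_mem Sg; exact: Sinj.
by apply: (card_le_trans SB); apply: subset_card_le => _ [f Sf <-]; exact: (SF f Sf B FB).
Qed.

Definition open_cover (X : topologicalType) (u : set (set X)) : Prop :=
  u `<=` open /\ \bigcup_(U in u) U = setT.

Definition lindelof (X : topologicalType) : Prop :=
  forall u : set (set X), open_cover u ->
  exists v, [/\ v `<=` u, countable v & \bigcup_(V in v) V = setT].

Definition hereditarily_lindelof (X : topologicalType) : Prop :=
  forall A : set X, lindelof (set_type A).

Definition menger (X : topologicalType) : Prop :=
  forall u : nat -> set (set X), (forall n, open_cover (u n)) ->
  exists v : nat -> set (set X),
    (forall n, v n `<=` u n /\ finite_set (v n)) /\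
    \bigcup_n \bigcup_(V in v n) V = setT.

(* [set_type B] carries the subspace topology, unlike [subspace B]. *)
Definition menger_ideal (X : topologicalType) : set (set X) :=
  [set A | exists2 B : set X, A `<=` B & menger (set_type B)].
Arguments menger_ideal X : clear implicits.

Definition add {X : Type} (I : set (set X)) : set (set X) :=
  least_card [set J | J `<=` I /\ ~ I (\bigcup_(A in J) A)].

Lemma addP (X : Type) (I : set (set X)) :
  \bigcup_(A in I) A = setT -> ~ I setT ->
  [/\ add I `<=` I, ~ I (\bigcup_(A in add I) A) &
    forall J, J `<=` I -> ~ I (\bigcup_(A in J) A) -> add I #<= J].
Proof.
move=> IT nIT; pose F := [set J | J `<=` I /\ ~ I (\bigcup_(A in J) A)].
have [|[addI naddI] addle] := @least_cardP _ F.
  by exists I; split=> //; rewrite IT.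
by split=> // J JI nJ; exact: addle.
Qed.

Definition baire_space : topologicalType := prod_topology (fun _ : nat => nat).

Section groupwise_density.
Context {C : Type}.
Implicit Types (A B : set C) (D : set (set C)).

Definition almost_subset A B : Prop := finite_set (A `\` B).

Definition open_family D : Prop :=
  D `<=` [set A | infinite_set A] /\
  forall A B, infinite_set A -> D B -> almost_subset A B -> D A.

Definition groupwise_dense D : Prop :=
  open_family D /\
  forall P : set (set C), infinite_set P -> P `<=` finite_set ->
    trivIset P id ->
  exists H, [/\ H `<=` P, infinite_set H & D (\bigcup_(A in H) A)].

End groupwise_density.

(* The index set is [nat]; the cardinal is the same for every countably
   infinite set. *)
Definition groupwise_density_number : set (set (set nat)) :=
  least_card [set G | G `<=` groupwise_dense /\ \bigcap_(D in G) D = set0].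

Lemma groupwise_density_numberP :
  [/\ groupwise_density_number `<=` groupwise_dense,
    \bigcap_(D in groupwise_density_number) D = set0 &
    forall G : set (set (set nat)), G `<=` groupwise_dense ->
      \bigcap_(D in G) D = set0 -> groupwise_density_number #<= G].
Proof.
pose F := [set G : set (set (set nat)) |
  G `<=` groupwise_dense /\ \bigcap_(D in G) D = set0].
have [|[gG g0] gle] := @least_cardP _ F; last first.
  by split=> // G GG G0; exact: gle.
pose N (A : set nat) := [set B : set nat | infinite_set B /\ infinite_set (A `\` B)].
exists (N @` [set A | infinite_set A]); split; last first.
  rewrite -subset0 => B NB; have infB : infinite_set B.
    by have [] : N setT B by apply: NB; exists setT => //; exact: infinite_nat.
  have [_] : N B B by apply: NB; exists B.
  by rewrite setDv; apply; exact: finite_set0.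
move=> _ [A infA <-]; split; first split.
- by move=> B [].
- move=> A' B infA' [_ infAB] A'B; split=> // AA'; apply: infAB.
  apply: (@sub_finite_set _ _ ((A `\` A') `|` (A' `\` B))).
    by move=> x [Ax Bx]; have [?|?] := pselect (A' x); [right|left].
  by rewrite finite_setU.
- move=> P infP finP trivP.
  have bigU_inf (H : set (set nat)) : infinite_set H ->
      infinite_set (\bigcup_(A in H) A).
    move=> infH finU; apply: infH; set U := \bigcup_(A in H) A in finU.
    apply: (@sub_finite_set _ _
      ((fun Y : {fset nat} => [set` Y]) @` [set` fpowerset (fset_set U)])).
      move=> B HB; have BU : B `<=` U by move=> x Bx; exists B.
      have finB := sub_finite_set BU finU.
      exists (fset_set B); last by rewrite fset_setK.
      by rewrite /= fpowersetE -fset_set_sub.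
    exact/finite_image/finite_fset.
  have [H1 [H2 [H1P H2P infH1 infH2 H12]]] : exists H1 H2, [/\ H1 `<=` P, H2 `<=` P,
     infinite_set H1, infinite_set H2 & H1 `&` H2 = set0].
    move/infiniteP: (infP) => /pcard_leP/unsquash f.
    have fI : injective f by move=> m n; apply: inj; rewrite inE.
    have fP n : P (f n) by exact: funS.
    have infR (g : nat -> nat) : injective g -> infinite_set (range (f \o g)).
      move=> gI; apply/infiniteP.
      by have /card_eqPle[] : range (f \o g) #= [set: nat]
        by apply: inj_card_eq => m n _ _ /fI/gI.
    exists (range (f \o double)), (range (f \o (S \o double))); split.
    + by move=> _ [n _ <-]; exact: fP.
    + by move=> _ [n _ <-]; exact: fP.
    + by apply: infR; exact: double_inj.
    + by apply: infR => m n [] /double_inj.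
    + rewrite -subset0 => _ [[m _ <-] [n _ /= /fI/(congr1 odd)]].
      by rewrite /= !odd_double.
  have [fin1|inf1] := pselect (finite_set (A `\` \bigcup_(A in H1) A)); last first.
    by exists H1; split=> //; split=> //; exact: bigU_inf.
  exists H2; split=> //; split; first exact: bigU_inf.
  move=> fin2; apply: infA; move: (conj fin1 fin2); rewrite -finite_setU.
  apply: sub_finite_set => x Ax.
  have [[B1 HB1 B1x]|] := pselect ((\bigcup_(A in H1) A) x); last by left.
  right; split=> // -[B2 HB2 B2x].
  have B12 : B1 = B2.
    by apply: trivP; [exact: H1P|exact: H2P|exists x].
  suff : (H1 `&` H2) B1 by rewrite H12.
  by split=> //; rewrite B12.
Qed.

(* Main.v *)
Require Import Defs.
From mathcomp Require Import all_boot finmap all_classical topology.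

(** Both inequalities come from one reading of the failure of the Menger
    property.  When [Z] is Lindelof, its open covers may be taken to be
    increasing sequences [W n m] ([m] in [nat]), and [Z] is Menger iff one can
    pick a single [h n] for each [n] so that the sets [W n (h n)] cover [Z]
    ([menger_set]).  If this fails, put [f n z] := the least [m] such that
    [W n m] contains [z].  The functions [f n] are upper semicontinuous on [Z],
    and failure means exactly that [f] beats every [h : nat -> nat]: for each
    [h] some [z] in [Z] has [h n < f n z] for all [n]
    ([not_menger_set_dominating]).  On a Menger set no sequence of upper
    semicontinuous functions can do this ([menger_set_bound]).

    Now let [J] be a family of sets in the ideal M(X) whose union is not in the
    ideal.  Enlarge its members to Menger sets [C A]; their union is not Menger
    and carries such an [f] ([dominating_of_not_menger_ideal]).

    First inequality: replace [C A] by the set of all [g] in the Baire space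
    lying pointwise below [(f n z)_n] for some [z] in [C A].  This is the image
    of [C A] by an upper semicontinuous compact-valued map, since the
    functions below a given one form a compact box; hence it is Menger
    ([menger_lower_hull]).  The union of these sets still beats every [h], so
    it lies in no Menger set.  Thus the Baire space has a family at most as
    large as [J] witnessing its additivity ([card_le_menger_ideal_baire]).

    Second inequality: make [f] nondecreasing in [n] by setting
    [y n z] := the sum of [f i z] over [i <= n], and associate to [A] in [J]
    the family of infinite sets [D] of naturals such that, for every [z] in
    [C A], [D] misses [[n, y n z[] for infinitely many [n] ([with_gaps]).  This
    family is groupwise dense because [C A] is Menger
    ([groupwise_dense_with_gaps]).  A set [D] common to all these families
    would give an [h], sending [n] to a member of [D] above [n], that is beaten
    by no [z], a contradiction.  So at most [#|J|] groupwise dense families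
    have empty intersection.  The two inequalities follow by taking [J] of
    least cardinality, in [X] and in the Baire space respectively; the latter
    is hereditarily Lindelof ([baire_hereditarily_lindelof]). *)

Local Open Scope classical_set_scope.
Local Open Scope card_scope.

(** * Filters and sets of natural numbers *)

Lemma finite_subset_bound {T : Type} (F : set T) (P : T -> nat -> Prop) :
  finite_set F -> (forall x m k, (m <= k)%N -> P x m -> P x k) ->
  (forall x, F x -> exists m, P x m) -> exists m, forall x, F x -> P x m.
Proof.
move=> finF Pmono FP.
have /choice[g gP] : forall x, exists m, F x -> P x m.
  move=> x; have [/FP[m Pm]|nFx] := pselect (F x); first by exists m.
  by exists 0%N.
have /finite_seqP[s gFs] : finite_set (g @` F) by exact: finite_image.
exists (\max_(i <- s) i) => x Fx; apply: (Pmono x (g x)); last exact: gP.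
apply: leq_bigmax_seq => //.
by have : [set` s] (g x) by rewrite -gFs; exists x.
Qed.

Lemma near_all_lt {T : Type} (F : set_system T) {FF : Filter F} (P : nat -> T -> Prop) N :
  (forall i, (i < N)%N -> \forall w \near F, P i w) ->
  \forall w \near F, forall i, (i < N)%N -> P i w.
Proof.
elim: N => [_|N IH PN]; first by apply: filterE => w i.
have h1 := PN N (ltnSn N).
have h2 : \forall w \near F, forall i, (i < N)%N -> P i w.
  by apply: IH => i iN; apply: PN; exact: ltnW.
apply: filterS2 h1 h2 => w PNw Pw i; rewrite ltnS leq_eqVlt => /orP[/eqP->//|].
exact: Pw.
Qed.

Lemma nondecreasing_majorant (q : nat -> nat) : exists2 p : nat -> nat,
  {homo p : m n / (m <= n)%N} & forall n, (q n <= p n)%N.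
Proof.
exists (fun n => \max_(i < n.+1) q i) => [m n mn|n].
  apply/bigmax_leqP => i _.
  by apply: (bigmax_sup (Ordinal (leq_trans (ltn_ord i) (mn : (m.+1 <= n.+1)%N)))).
exact: (bigmax_sup ord_max).
Qed.

Lemma infinite_nat_unbounded (A : set nat) : infinite_set A <->
  forall n, exists2 a, A a & (n <= a)%N.
Proof.
split=> [infA n|ubA finA].
  apply: contrapT => nA; apply: infA; apply: sub_finite_set (finite_II n) => a Aa /=.
  by rewrite ltnNge; apply/negP => na; apply: nA; exists a.
have [||m mP] := finite_subset_bound A (fun a m => (a < m)%N) finA.
- by move=> a m k mk am; exact: leq_trans mk.
- by move=> a _; exists a.+1.
by have [a /mP] := ubA m; rewrite ltnNge => /negP.
Qed.

(** By disjointness, a member of [P] that meets [0, n[ is recovered from any of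
    its elements below [n], so only finitely many members do. *)
Lemma infinite_trivIset_above (P : set (set nat)) n : infinite_set P ->
  trivIset P id -> exists Q, [/\ P Q, Q !=set0 & forall a, Q a -> (n <= a)%N].
Proof.
move=> infP trivP; apply: contrapT => nQ; apply: infP.
pose F i := \bigcup_(B in [set B | P B /\ B i]) B.
apply: (@sub_finite_set _ _ ([set set0] `|` F @` `I_n)); last first.
  by rewrite finite_setU; split; [exact: finite_set1|exact/finite_image/finite_II].
move=> Q PQ; have [->|/set0P Q0] := eqVneq Q set0; [by left|right].
have [a [Qa an]] : exists a, Q a /\ (a < n)%N.
  apply: contrapT => na; apply: nQ; exists Q; split=> // a Qa.
  by rewrite leqNgt; apply/negP => an; apply: na; exists a.
exists a => //; apply/seteqP; split=> [x [B [PB Ba] Bx]|x Qx]; last by exists Q.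
by rewrite (trivP Q B PQ PB) //; exists a.
Qed.

(** * Menger sets and increasing open covers *)

Section Menger.
Context {X : topologicalType}.
Implicit Types (A B Z : set X).

(** For Lindelof [B] this is the Menger property of the subspace [B], phrased
    with open sets of the ambient space and with covers that are increasing
    sequences, so that a finite choice from a cover is a single index. *)
Definition menger_set B := forall W : nat -> nat -> set X,
  (forall n m, open (W n m)) ->
  (forall n m k, (m <= k)%N -> W n m `<=` W n k) ->
  (forall n, B `<=` \bigcup_m W n m) ->
  exists h : nat -> nat, B `<=` \bigcup_n W n (h n).

Lemma open_set_typeP B (V : set (set_type B)) :
  open V <-> exists2 O : set X, open O & set_val @^-1` O = V.
Proof. by split. Qed.

Lemma menger_set_of_menger B : menger (set_type B) -> menger_set B.
Proof.
move=> MB W oW incW covW.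
pose u n : set (set B) := range (fun m => set_val @^-1` (W n m)).
have [n|v [vP vcov]] := MB u.
  split; first by move=> _ [m _ <-]; apply/open_set_typeP; exists (W n m).
  rewrite -subTset => x _; have [m _ Wm] := covW n _ (set_valP x).
  by exists (set_val @^-1` (W n m)) => //; exists m.
have /choice[h hP] n : exists m, forall V, v n V -> V `<=` set_val @^-1` (W n m).
  have [vu finv] := vP n.
  apply: (@finite_subset_bound _ _ (fun V m => V `<=` set_val @^-1` (W n m))) => //.
    by move=> V m k mk Vm x /Vm; exact: incW.
  by move=> V /vu[m _ <-]; exists m.
exists h => x Bx.
have : [set: B] (exist _ x (mem_set Bx)) by [].
by rewrite -vcov => -[n _ [V vV Vx]]; exists n => //; exact: (hP n V vV _ Vx).
Qed.

(** A countable cover is turned into an increasing one by letting [W n m] be the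
    union of the members numbered at most [m]; choosing an index then amounts to
    choosing finitely many members. *)
Lemma menger_of_menger_set B :
  lindelof (set_type B) -> menger_set B -> menger (set_type B).
Proof.
move=> LB MB u ucov.
have /choice[v vP] n : exists v, [/\ v `<=` u n, countable v & \bigcup_(V in v) V = setT].
  exact: LB.
have /choice[i iI] n : exists i : set B -> nat, {in v n &, injective i}.
  by have [_ /countable_injP] := vP n.
have /choice[O OP] (V : set B) : exists O : set X,
    open V -> open O /\ set_val @^-1` O = V.
  have [/open_set_typeP[O oO OV]|nV] := pselect (open V); first by exists O.
  by exists set0.
have vo n V : v n V -> open V.
  by have [vu _ _] := vP n; move=> /vu; exact: (ucov n).1.
pose W n m := \bigcup_(V in [set V | v n V /\ (i n V <= m)%N]) O V.
have [n m|n m k mk x [V [vV iV] OV]|n x Bx|h hP] := MB W.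
- by apply: bigcup_open => V [/vo/OP[]].
- by exists V => //; split=> //; exact: leq_trans mk.
- have [_ _] := vP n => /seteqP[_ /(_ (exist _ x (mem_set Bx)) I)[V vV Vx]].
  have [_ OV] := OP V (vo _ _ vV).
  exists (i n V) => //; exists V => //.
  by rewrite -OV in Vx.
exists (fun n => [set V | v n V /\ (i n V <= h n)%N]); split.
  move=> n; split; first by have [vu _ _] := vP n; move=> V [/vu].
  have /card_eqPle[_ iA] : i n @` [set V | v n V /\ (i n V <= h n)%N] #=
      [set V | v n V /\ (i n V <= h n)%N].
    apply: inj_card_eq => V V' /set_mem[vV _] /set_mem[vV' _].
    by apply: (iI n); exact: mem_set.
  apply: (card_le_finite iA); apply: sub_finite_set (finite_II (h n).+1).
  by move=> _ [V [_ iV] <-].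
rewrite -subTset => x _.
have [n _ [V [vV iV] OV]] := hP _ (set_valP x).
exists n => //; exists V => //.
by have [_ <-] := OP V (vo _ _ vV).
Qed.

(** The form in which the Menger property is used: [R n m z] reads as [m bounds
    the n-th quantity at z], and it suffices that each such quantity be locally
    bounded on [B]. *)
Lemma menger_set_bound B (R : nat -> nat -> set X) : menger_set B ->
  (forall n m k, (m <= k)%N -> R n m `<=` R n k) ->
  (forall n z, B z -> exists m, \forall w \near z, B w -> R n m w) ->
  exists h : nat -> nat, forall z, B z -> exists n, R n (h n) z.
Proof.
move=> MB incR Rnear.
have [n m|n m k mk z|n z Bz|h hP] :=
    MB (fun n m => interior [set w | B w -> R n m w]).
- exact: open_interior.
- by apply: filterS => w Rw /Rw; exact: incR.
- by have [m ?] := Rnear n z Bz; exists m.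
exists h => z Bz; have [n _ /nbhs_singleton Rz] := hP z Bz.
by exists n; exact: Rz.
Qed.

(** Upper semicontinuity of the restriction of [g] to the subspace [Z]; as the
    values are naturals, no epsilon is needed. *)
Definition usc_on Z (g : X -> nat) :=
  forall z, Z z -> \forall w \near z, Z w -> (g w <= g z)%N.

(** The witness is [f n z] := the least index of a member of the [n]-th cover
    that contains [z], where the covers refute the Menger property of [Z]. *)
Lemma not_menger_set_dominating Z : ~ menger_set Z ->
  exists f : nat -> X -> nat, (forall n, usc_on Z (f n)) /\
    forall h : nat -> nat, exists2 z, Z z & forall n, (h n < f n z)%N.
Proof.
move=> nM; apply: contrapT => nf; apply: nM => W oW incW covW.
apply: contrapT => nh; apply: nf.
have /choice[f fP] (nz : nat * X) : exists m, Z nz.2 -> W nz.1 m nz.2 /\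
    forall k, W nz.1 k nz.2 -> (m <= k)%N.
  case: nz => n z /=; have [Zz|nZ] := pselect (Z z); last by exists 0%N.
  have ex : exists m, `[< W n m z >].
    by have [m _ Wm] := covW n z Zz; exists m; exact/asboolP.
  case: (ex_minnP ex) => m /asboolP Wm mmin; exists m => _; split=> // k Wk.
  by apply: mmin; exact/asboolP.
exists (fun n z => f (n, z)); split=> [n z Zz|h].
  have [/= Wz _] := fP (n, z) Zz.
  apply: (@filterS _ _ _ (W n (f (n, z)))) => [w Ww Zw|]; last exact: open_nbhs_nbhs.
  exact: (fP (n, w) Zw).2.
apply: contrapT => nz; apply: nh; exists h => z Zz.
apply: contrapT => nW; apply: nz; exists z => // n.
rewrite ltnNge; apply/negP => le; apply: nW; exists n => //.
by apply: (incW n _ _ le); exact: (fP (n, z) Zz).1.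
Qed.

End Menger.


(** * The Baire space *)

Section Baire.

Lemma cylinder_nbhs (g : baire_space) N :
  \forall g' \near g, forall i, (i < N)%N -> g' i = g i.
Proof.
apply: (near_all_lt (nbhs g) (fun i (g' : baire_space) => g' i = g i)) => i _.
by apply: (@proj_continuous nat (fun=> nat) i g [set m | m = g i]) => /=.
Qed.

(** The cylinders at [g] generate a filter along which every coordinate
    converges, so this filter converges to [g] in the product topology. *)
Lemma nbhs_cylinder (g : baire_space) (W : set baire_space) : nbhs g W ->
  exists N, forall g' : baire_space, (forall i, (i < N)%N -> g' i = g i) -> W g'.
Proof.
pose F : set_system baire_space := [set V | exists N, forall g' : baire_space,
  (forall i, (i < N)%N -> g' i = g i) -> V g'].
have FF : Filter F.
  split.
  - by exists 0%N.
  - move=> P Q [N PN] [M QM]; exists (maxn N M) => g' gg'; split.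
      by apply: PN => i iN; apply: gg'; rewrite leq_max iN.
    by apply: QM => i iN; apply: gg'; rewrite leq_max iN orbT.
  - by move=> P Q PQ [N PN]; exists N => g' /PN /PQ.
suff : {ptws, F --> g} by apply.
apply/(@pointwise_cvgP _ _ F g FF) => t A /= At.
by exists t.+1 => g' /(_ t (ltnSn t)) /= ->; exact: nbhs_singleton.
Qed.

(** Cylinders are indexed by finite sequences, hence countable in number; from a
    cover it is enough to keep one member containing each cylinder that lies in
    some member. *)
Lemma baire_hereditarily_lindelof : hereditarily_lindelof baire_space.
Proof.
move=> A u [uo ucov].
pose cyl (s : seq nat) : set (set_type A) := [set x | mkseq (set_val x) (size s) = s].
have /choice[U UP] (s : seq nat) : exists U, (exists2 V, u V & cyl s `<=` V) ->
    u U /\ cyl s `<=` U.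
  have [[V uV sV]|nV] := pselect (exists2 V, u V & cyl s `<=` V); first by exists V.
  by exists set0.
exists (U @` [set s | exists2 V, u V & cyl s `<=` V]); split.
- by move=> _ [s /UP[? _] <-].
- by apply: (card_le_trans (card_image_le _ _)); exact: countableP.
rewrite -subTset => x _.
have [V uV Vx] : (\bigcup_(V in u) V) x by rewrite ucov.
have /open_set_typeP[O oO OV] := uo V uV.
have Ox : O (set_val x) by rewrite -OV in Vx.
have [N NO] : exists N, forall g' : baire_space,
    (forall i, (i < N)%N -> g' i = set_val x i) -> O g'.
  by apply: nbhs_cylinder; exact: open_nbhs_nbhs.
have sV : cyl (mkseq (set_val x) N) `<=` V.
  move=> w; rewrite /cyl /= size_mkseq => wx; rewrite -OV; apply: NO => i iN.
  by have := congr1 (nth 0%N ^~ i) wx; rewrite !nth_mkseq.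
have [_ sU] := UP _ (ex_intro2 _ _ V uV sV).
exists (U (mkseq (set_val x) N)); first by exists (mkseq (set_val x) N) => //; exists V.
by apply: sU; rewrite /cyl /= size_mkseq.
Qed.

(** Compactness of the box below [b], with a margin: not only does one [W m]
    contain the box, it contains all functions that obey the bound on finitely
    many coordinates.  This is what makes taking boxes upper semicontinuous. *)
Lemma box_increasing_cover (W : nat -> set baire_space) (b : nat -> nat) :
  (forall m, open (W m)) -> (forall m k, (m <= k)%N -> W m `<=` W k) ->
  (forall g : baire_space, (forall i, (g i <= b i)%N) -> exists m, W m g) ->
  exists m, forall g : baire_space, (forall i, (i < m)%N -> (g i <= b i)%N) -> W m g.
Proof.
move=> oW incW covW; apply: contrapT => nW.
have /choice[g gP] m : exists g : baire_space,
    (forall i, (i < m)%N -> (g i <= b i)%N) /\ ~ W m g.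
  apply: contrapT => ng; apply: nW; exists m => g gb.
  by apply: contrapT => nWg; apply: ng; exists g.
(* The counterexample [g m] need not lie in the box; its truncation [t m] does,
   and it agrees with [g m] below [m], which is all that cylinders see. *)
pose t m : baire_space := fun i => if (i < m)%N then g m i else 0%N.
have Kb : compact [set f : baire_space | forall i, `I_(b i).+1 (f i)].
  apply: (@tychonoff nat (fun=> nat) (fun i => `I_(b i).+1)) => i.
  exact/finite_compact/finite_II.
have [p [pb clp]] : [set f : baire_space | forall i, `I_(b i).+1 (f i)] `&`
    cluster (t @ \oo) !=set0.
  apply: Kb; exists 0%N => // m _ i; rewrite /t /=; case: ifP => // im.
  by rewrite ltnS; exact: (gP m).1.
have [k Wk] := covW p pb.
have [N NW] : exists N, forall g' : baire_space,
    (forall i, (i < N)%N -> g' i = p i) -> W k g'.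
  by apply: nbhs_cylinder; exact: open_nbhs_nbhs.
have [_ [[m /= mge <-] tp]] : [set t m | m in [set m | (maxn k N <= m)%N]] `&`
    [set g' : baire_space | forall i, (i < N)%N -> g' i = p i] !=set0.
  apply: clp; last exact: cylinder_nbhs.
  by exists (maxn k N) => // m mge; exists m.
have [km Nm] : (k <= m)%N /\ (N <= m)%N by move: mge; rewrite geq_max => /andP.
apply: (gP m).2; apply: (incW k m km); apply: NW => i iN.
by rewrite -tp // /t (leq_trans iN).
Qed.

End Baire.

(** * From an arbitrary space to the Baire space *)

Section LowerHull.
Context {X : topologicalType}.
Implicit Types (B Z : set X) (f : nat -> X -> nat).

Lemma sub_usc_on B Z (g : X -> nat) : B `<=` Z -> usc_on Z g -> usc_on B g.
Proof.
move=> BZ gZ z /BZ /gZ; apply: filterS => w gw /BZ; exact: gw.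
Qed.

Lemma usc_on_near B f : (forall n, usc_on B (f n)) -> forall N z, B z ->
  \forall w \near z, B w -> forall i, (i < N)%N -> (f i w <= f i z)%N.
Proof.
move=> fB N z Bz.
have := @near_all_lt _ _ (nbhs_filter z) (fun i w => B w -> (f i w <= f i z)%N) N.
by move=> /(_ (fun i _ => fB i z Bz)); apply: filterS => w fw Bw i iN; exact: fw.
Qed.

(** Taking all functions below [(f n z)_n], instead of this function alone,
    compensates for the fact that [f n] is only semicontinuous: although
    [z |-> (f n z)_n] need not be continuous, the map sending [z] to the box
    below it is upper semicontinuous with compact values, and such maps preserve
    the Menger property. *)
Definition lower_hull f B : set baire_space :=
  [set g | exists2 z, B z & forall i, (g i <= f i z)%N].

Lemma menger_lower_hull B f : (forall n, usc_on B (f n)) ->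
  menger_set B -> menger_set (lower_hull f B).
Proof.
move=> fB MB W oW incW covW.
pose R n m : set X :=
  [set z | forall g : baire_space, (forall i, (g i <= f i z)%N) -> W n m g].
have [n m k mk z Rz g /Rz|n z Bz|h hP] := menger_set_bound _ R MB.
- exact: incW.
- have [|m mP] := box_increasing_cover (W n) (fun i => f i z) (oW n) (incW n).
    by move=> g gz; have [|m _ Wm] := covW n g; [exists z|exists m].
  exists m; apply: filterS (usc_on_near _ _ fB m _ Bz) => w fw Bw g gw.
  by apply: mP => i im; apply: leq_trans (gw i) _; exact: fw.
- by exists h => g [z Bz gz]; have [n Rn] := hP z Bz; exists n => //; exact: Rn.
Qed.

End LowerHull.

Section Ideal.
Context {X : topologicalType} (hX : hereditarily_lindelof X).

Lemma menger_idealP (A : set X) :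
  menger_ideal X A <-> exists2 B, A `<=` B & menger_set B.
Proof.
split=> -[B AB MB]; exists B => //; first exact: menger_set_of_menger.
exact: menger_of_menger_set.
Qed.

Lemma menger_ideal1 (x : X) : menger_ideal X [set x].
Proof.
apply/menger_idealP; exists [set x] => // W _ _ covW.
have [m _ Wm] := covW 0%N x erefl.
by exists (fun=> m) => _ ->; exists 0%N.
Qed.

(** The members of [J] have to be enlarged to Menger sets first: the open covers
    produced by [not_menger_set_dominating] cover the union of the sets to which
    it is applied, and need not cover a Menger set containing a member of [J]. *)
Lemma dominating_of_not_menger_ideal (J : set (set X)) :
  J `<=` menger_ideal X -> ~ menger_ideal X (\bigcup_(A in J) A) ->
  exists (C : set X -> set X) (f : nat -> X -> nat),
  [/\ forall A, J A -> menger_set (C A),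
      forall A n, J A -> usc_on (C A) (f n) &
      forall h : nat -> nat, exists A z,
        [/\ J A, C A z & forall n, (h n < f n z)%N]].
Proof.
move=> JM nM.
have /choice[C CP] (A : set X) : exists B, J A -> A `<=` B /\ menger_set B.
  have [/JM/menger_idealP[B AB MB]|nJ] := pselect (J A); first by exists B.
  by exists set0.
have [|f [fusc fdom]] := @not_menger_set_dominating _ (\bigcup_(A in J) C A).
  move=> MZ; apply: nM; apply/menger_idealP; exists (\bigcup_(A in J) C A) => //.
  by move=> x [A JA Ax]; exists A => //; exact: (CP A JA).1.
exists C, f; split=> [A /CP[]//|A n JA|h].
  by apply: sub_usc_on _ _ _ _ (fusc n) => z Cz; exists A.
by have [z [A JA Cz] hz] := fdom h; exists A, z.
Qed.

(** The coordinate functions are continuous, so on a Menger set containing [Z]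
    some [h] would bound at least one coordinate of every point. *)
Lemma not_menger_ideal_dominating (Z : set baire_space) :
  (forall h : nat -> nat, exists2 g, Z g & forall n, (h n < g n)%N) ->
  ~ menger_ideal baire_space Z.
Proof.
move=> Zdom [B ZB /menger_set_of_menger MB].
have [n m k mk g /= gm|n g Bg|h hP] :=
    menger_set_bound _ (fun n m => [set g : baire_space | (g n <= m)%N]) MB.
- exact: leq_trans mk.
- by exists (g n); apply: filterS (cylinder_nbhs g n.+1) => w /= /(_ n (ltnSn n)) ->.
have [g Zg hg] := Zdom h.
by have [n /=] := hP g (ZB g Zg); rewrite leqNgt hg.
Qed.

Lemma card_le_menger_ideal_baire (J : set (set X)) :
  J `<=` menger_ideal X -> ~ menger_ideal X (\bigcup_(A in J) A) ->
  exists J' : set (set baire_space), [/\ J' #<= J, J' `<=` menger_ideal baire_space &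
    ~ menger_ideal baire_space (\bigcup_(A in J') A)].
Proof.
move=> JM nM; have [C [f [MC fusc fdom]]] := dominating_of_not_menger_ideal _ JM nM.
exists ((fun A => lower_hull f (C A)) @` J); split; first exact: card_image_le.
- move=> _ [A JA <-]; exists (lower_hull f (C A)) => //.
  apply: menger_of_menger_set; first exact: baire_hereditarily_lindelof.
  by apply: menger_lower_hull; [move=> n; exact: fusc|exact: MC].
- apply: not_menger_ideal_dominating => h; have [A [z [JA Cz hz]]] := fdom h.
  exists (fun n => f n z) => //; exists (lower_hull f (C A)); first by exists A.
  by exists z.
Qed.

End Ideal.

(** * Groupwise dense families from Menger sets *)

Section Gaps.
Context {X : topologicalType}.
Implicit Types (B : set X).

(** The single hit given by [menger_set_bound] is made to recur by applying it
    to each tail of the sequence [g]. *)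
Lemma menger_set_infinitely_often B (g : nat -> X -> nat) :
  menger_set B -> (forall n, usc_on B (g n)) ->
  exists2 h : nat -> nat, {homo h : m n / (m <= n)%N} &
    forall z, B z -> forall m, exists2 n, (m <= n)%N & (g n z <= h n)%N.
Proof.
move=> MB gB.
have /choice[t tP] m : exists t : nat -> nat, forall z, B z ->
    exists n, (g (n + m) z <= t n)%N.
  apply: (menger_set_bound _ (fun n k => [set z | (g (n + m) z <= k)%N]) MB).
    by move=> n k l kl z /= gk; exact: leq_trans kl.
  by move=> n z Bz; exists (g (n + m) z); exact: gB.
have [h hmono hP] := nondecreasing_majorant (fun n => \max_(j < n.+1) t j (n - j)%N).
exists h => // z Bz m; have [n gn] := tP m z Bz.
exists (n + m)%N; first exact: leq_addl.
apply: leq_trans (hP _); apply: (leq_trans gn).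
have mn : (m < (n + m).+1)%N by rewrite ltnS leq_addl.
have := @leq_bigmax _ (fun j : 'I_(n + m).+1 => t j (n + m - j)%N) (Ordinal mn).
by rewrite /= addnK.
Qed.

(** The gaps of [A] are the intervals [[n, y n z[] that it misses; removing
    elements of [A], or changing finitely many, keeps almost all of them, hence
    [open_family_with_gaps]. *)
Definition with_gaps B (y : nat -> X -> nat) : set (set nat) :=
  [set A | infinite_set A /\ forall z, B z -> forall m,
    exists2 n, (m <= n)%N & forall a, A a -> (n <= a)%N -> (y n z <= a)%N].

Lemma open_family_with_gaps B y : open_family (with_gaps B y).
Proof.
split=> [A []//|A A' infA [_ A'gap] AA'].
split=> // z Bz m.
have [||N NP] := finite_subset_bound (A `\` A') (fun a m => (a < m)%N) AA'.
- by move=> a k l kl ak; exact: leq_trans kl.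
- by move=> a _; exists a.+1.
have [n] := A'gap z Bz (maxn m N); rewrite geq_max => /andP[mn Nn] gap.
exists n => // a Aa na; apply: gap => //; apply: contrapT => nA'a.
by have := NP a (conj Aa nA'a); rewrite ltnNge (leq_trans Nn).
Qed.

(** Every [n] has a member [Q n] of [P] inside [[n, p n[], with [p] monotone.
    Selecting [Q (s k)] with [s] increasing fast enough leaves the gaps
    [[e k, s k.+1[], where [e k = p (s k)].  For a fixed [z] one needs
    [y (e k) z <= s k.+1] infinitely often, but an [h] that bounds [y n z]
    infinitely often only gives [y (e k) z <= s k.+2], because the good [n] lies
    anywhere between [e k] and [e k.+1].  Bounding the iterate [y (p (y n z)) z]
    instead recovers the lost step: if [y] jumps over the gap after [e k], then
    [p] after [y] already reaches [e k.+1], so the second [y] starts there and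
    the bound shows that it does not jump over the next gap. *)
Lemma groupwise_dense_with_gaps B (y : nat -> X -> nat) : menger_set B ->
  (forall n, usc_on B (y n)) -> (forall z, {homo y ^~ z : m n / (m <= n)%N}) ->
  groupwise_dense (with_gaps B y).
Proof.
move=> MB yB ymono; split; first exact: open_family_with_gaps.
move=> P infP finP trivP.
have /choice[Q QP] n := infinite_trivIset_above P n infP trivP.
have /choice[q qP] n : exists m, forall a, Q n a -> (a < m)%N.
  apply: (finite_subset_bound (Q n) (fun a m => (a < m)%N)).
  - by apply: finP; case: (QP n).
  - by move=> a m k mk am; exact: leq_trans mk.
  - by move=> a _; exists a.+1.
have [p pmono qp] := nondecreasing_majorant q.
have Qp n a : Q n a -> (n <= a < p n)%N.
  move=> Qa; have [_ _ Qn] := QP n; rewrite Qn //=.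
  exact: leq_trans (qP n a Qa) (qp n).
have ltp n : (n < p n)%N.
  by have [_ [a /Qp /andP[na ap]] _] := QP n; exact: leq_ltn_trans ap.
have yyB n : usc_on B (fun w => y (p (y n w)) w).
  move=> z Bz; apply: filterS (usc_on_near _ _ yB (maxn n (p (y n z))).+1 _ Bz).
  move=> w yw Bw; apply: (@leq_trans (y (p (y n z)) w)).
    by apply: ymono; apply: pmono; apply: yw; rewrite // ltnS leq_maxl.
  by apply: yw; rewrite // ltnS leq_maxr.
have [h hmono hP] := menger_set_infinitely_often _ _ MB yyB.
pose s k := iter k (fun s => maxn (h (p s)) (p s)) 0%N.
have sS k : s k.+1 = maxn (h (p (s k))) (p (s k)) by [].
have lts k : (s k < s k.+1)%N by rewrite sS leq_max ltp orbT.
have smono : {homo s : m n / (m <= n)%N}.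
  by apply: homo_leq => //; [exact: leq_trans|move=> k; exact: ltnW].
have sge k : (k <= s k)%N.
  by elim: k => // k IH; exact: leq_ltn_trans IH (lts k).
pose e k := p (s k).
have emono : {homo e : m n / (m <= n)%N} by move=> m n mn; exact/pmono/smono.
have ege k : (k <= e k)%N by apply: leq_trans (sge k) (ltnW (ltp _)).
pose H := range (Q \o s); pose A := \bigcup_(D in H) D.
have gapA k a : A a -> (e k <= a)%N -> (s k.+1 <= a)%N.
  move=> [_ [j _ <-] /= /Qp /andP[sa ae]] ea.
  have [jk|kj] := leqP j k.
    by have := leq_trans ae (leq_trans (emono _ _ jk) ea); rewrite ltnn.
  exact: leq_trans (smono _ _ kj) sa.
have infA : infinite_set A.
  apply/infinite_nat_unbounded => n.
  have [_ [a Qa] Qn] := QP (s n).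
  exists a; first by exists (Q (s n)) => //; exists n.
  exact: leq_trans (sge n) (Qn a Qa).
have HP : H `<=` P by move=> _ [k _ <-]; case: (QP (s k)).
exists H; split=> //.
  by move=> finH; apply: infA; apply: bigcup_finite => // D /HP; exact: finP.
split=> // z Bz m.
have [n emn ynh] := hP z Bz (e m).
have [k [mk ekn nek]] : exists k, [/\ (m <= k)%N, (e k <= n)%N & (n < e k.+1)%N].
  have exk : exists k, (n < e k.+1)%N by exists n; exact: ege.
  case: (ex_minnP exk) => k nek kmin; exists k; split=> //.
    rewrite leqNgt; apply/negP => km.
    by have := leq_trans nek (leq_trans (emono _ _ km) emn); rewrite ltnn.
  case: k nek kmin => [|k] nek kmin; first exact: leq_trans (emono _ _ (leq0n m)) emn.
  by rewrite leqNgt; apply/negP => /kmin; rewrite ltnn.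
(* If the gap after [e k] is too short for [y], the next one is long enough. *)
have [yes|sy] := leqP (y (e k) z) (s k.+1).
  exists (e k) => [|a Aa ea]; first exact: leq_trans mk (ege k).
  exact: leq_trans yes (gapA k a Aa ea).
exists (e k.+1) => [|a Aa ea].
  by apply: leq_trans (leqW mk) (ege _).
apply: leq_trans (gapA k.+1 a Aa ea).
apply: (@leq_trans (y (p (y n z)) z)).
  apply/ymono/pmono; apply: leq_trans (ltnW sy) _; exact: ymono.
apply: (leq_trans ynh); rewrite sS leq_max; apply/orP; left.
by apply: hmono; exact: ltnW.
Qed.

End Gaps.

(** * The cardinal inequalities *)

Lemma groupwise_dense_of_not_menger_ideal (X : topologicalType)
    (hX : hereditarily_lindelof X) (J : set (set X)) :
  J `<=` menger_ideal X -> ~ menger_ideal X (\bigcup_(A in J) A) ->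
  exists G : set (set (set nat)), [/\ G #<= J, G `<=` groupwise_dense &
    \bigcap_(D in G) D = set0].
Proof.
move=> JM nM; have [C [f [MC fusc fdom]]] := dominating_of_not_menger_ideal hX _ JM nM.
pose y n z := \sum_(i < n.+1) f i z.
exists ((fun A => with_gaps (C A) y) @` J); split; first exact: card_image_le.
- move=> _ [A JA <-]; apply: groupwise_dense_with_gaps; first exact: MC.
    move=> n z Cz; apply: filterS (usc_on_near _ _ (fun i => fusc A i JA) n.+1 _ Cz).
    by move=> w fw Cw; apply: leq_sum => i _; exact: fw.
  move=> z; apply: homo_leq => [//||n]; first exact: leq_trans.
  by rewrite /y [leqRHS]big_ord_recr leq_addr.
rewrite -subset0 => D DG.
have infD : infinite_set D.
  have [A [_ [JA _ _]]] := fdom id.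
  by have [] : with_gaps (C A) y D by apply: DG; exists A.
have /choice[h hP] n : exists a, D a /\ (n <= a)%N.
  by have [a Da na] := (infinite_nat_unbounded D).1 infD n; exists a.
have [A [z [JA Cz hz]]] := fdom h.
have [_ gapD] : with_gaps (C A) y D by apply: DG; exists A.
have [n _ gap] := gapD z Cz 0%N.
have := gap _ (hP n).1 (hP n).2.
rewrite /y big_ord_recr /= => /(leq_trans (leq_addl _ _)).
by rewrite leqNgt hz.
Qed.

Theorem theorem4 (X : topologicalType) (hX : hereditarily_lindelof X)
    (hM : ~ menger_ideal X [set: X]) :
  add (menger_ideal X) #>= add (menger_ideal baire_space) /\
  add (menger_ideal baire_space) #>= groupwise_density_number.
Proof.
have [|addX naddX _] := addP _ hM.
  by rewrite -subTset => x _; exists [set x] => //; exact: menger_ideal1.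
have [J [JX JM nJ]] := card_le_menger_ideal_baire hX _ addX naddX.
have [|[addM naddM] addle] := @least_cardP _ [set J | J `<=` menger_ideal baire_space /\
    ~ menger_ideal baire_space (\bigcup_(A in J) A)]; first by exists J.
split; first exact: card_le_trans (addle J (conj JM nJ)) JX.
have [G [Gadd Ggd G0]] :=
  groupwise_dense_of_not_menger_ideal _ baire_hereditarily_lindelof _ addM naddM.
have [_ _ gle] := groupwise_density_numberP.
exact: card_le_trans (gle G Ggd G0) Gadd.
Qed.
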